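(* For the tokenized linear bandit (TLB) problem with horizon $T$ and maximal depth $L$, any algorithm suffers worst-case regret $$\Omega\Big(T\big(1-\tfrac{1}{2^{L-2}}\big)\Big).$$
   Context: **Sequences.** $\mathcal V$ is a finite token set, $|\mathcal V|=n$, containing a special end-of-sequence token $\mathrm{EOS}$. For a finite token sequence $\mathbf y$, $|\mathbf y|$ is its length and $\mathbf y^{(1:j)}$ is its prefix of length $j$. A sequence is complete if its last token is $\mathrm{EOS}$. Only algorithms that output complete sequences of length at most $L$ are considered; $L$ is known in advance. **TLB problem.** In each round $t\in[T]$ a user submits a query $x_t$ (a token sequence). The decision maker (DM) irrevocably chooses tokens one by one to build a complete sequence $\mathbf y_t$ with $|\mathbf y_t|\le L$, and then observes the reward $r_t(\mathbf y_t)=u_t(x_t,\mathbf y_t)+\eta_t$, where $\eta_t$ is random zero-mean noise with $|\eta_t|\le\sigma$. The nonnegative utility function is unknown to the DM and is linearly realizable: there are $\theta\in\mathbb R^d$ and an embedding function $e$, mapping a pair (query, token sequence) to a vector in $\mathbb R^d$, such that $u_t(x_t,\mathbf y)=\langle\theta,e(x_t,\mathbf y)\rangle$ for every query $x_t$ and token sequence $\mathbf y$. Here $\theta$ is a latent parameter unknown to the DM, $\|\theta\|\le1$, and the embedding vectors have norm at most $1$. The DM has query access to the embedding function $e$ during the decoding process (the token-by-token selection within a round). The regret is $\mathrm{Reg}=\sum_{t=1}^T\mathbb E[\max_{\mathbf z}r_t(\mathbf z)]-\sum_{t=1}^T\mathbb E[r_t(\mathbf y_t)]$, where $\mathbf z$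 ranges over complete sequences of length at most $L$. Worst-case regret means the regret on the worst TLB instance for the algorithm. **Assumptions on the utility.** The utility functions are assumed to be monotone and to have small single-level deviation. No further structural assumption relating the utilities of different sequences is imposed. - *Monotone:* (i) appending further $\mathrm{EOS}$ tokens to a sequence already ending in $\mathrm{EOS}$ does not change the utility; (ii) appending a non-$\mathrm{EOS}$ token to a sequence already ending in $\mathrm{EOS}$ only decreases the utility. - *Small single-level deviation:* let $\mathbf o$ be the optimal sequence in round $t$. For any sequence $\mathbf a$ that deviates from $\mathbf o$ for the first time at level (position) $i$, $|u_t(x_t,\mathbf o^{(1:i)})-u_t(x_t,\mathbf a^{(1:i)})|\le\varepsilon$, with $\varepsilon=O(1/\sqrt T)$.
   Formalization: With unlimited query access to the embedding function the claim fails (noiseless, d=1: regret at most 1), so when k tokens are chosen the DM may query only e(x_t,z) with z of length at most k+1; also n≥2 and d≥1 are assumed, as otherwise regret is zero. *)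

(* Defs.v *)
From HB Require Import structures.
From mathcomp Require Import all_boot all_order all_algebra.
From mathcomp Require Import all_classical all_reals all_analysis.

Set Implicit Arguments.
Unset Strict Implicit.
Unset Printing Implicit Defensive.

Import Order.TTheory GRing.Theory Num.Theory.
Import numFieldNormedType.Exports.

Local Open Scope classical_set_scope.
Local Open Scope ring_scope.

(* The library norm on ['rV[R]_d] is the sup norm, hence the explicit
   Euclidean norm. *)
Definition dotp (R : realType) (d : nat) (u v : 'rV[R]_d) : R :=
  \sum_(i < d) u 0 i * v 0 i.

Definition norm2 (R : realType) (d : nat) (u : 'rV[R]_d) : R :=
  Num.sqrt (dotp u u).

(* [EOS] may also occur before the last position: only the last token
   decides completeness. *)
Definition complete (V : finType) (EOS : V) (y : seq V) : bool :=
  (y != [::]) && (last EOS y == EOS).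

Definition monotone (R : realType) (V : finType) (EOS : V)
    (u : seq V -> R) : Prop :=
  (forall (y : seq V) (k : nat), complete EOS y -> u (y ++ nseq k EOS) = u y)
  /\ (forall (y : seq V) (a : V), complete EOS y -> a != EOS ->
        u (rcons y a) <= u y).

Definition optimal (R : realType) (V : finType) (EOS : V) (L : nat)
    (u : seq V -> R) (o : seq V) : Prop :=
  [/\ complete EOS o, (size o <= L)%N
    & forall z : seq V, complete EOS z -> (size z <= L)%N -> u z <= u o].

(* Positions are counted from 1. *)
Definition first_deviation (V : finType) (o a : seq V) (i : nat) : Prop :=
  [/\ (0 < i <= minn (size o) (size a))%N,
      take i.-1 a = take i.-1 o & take i a <> take i o].

Definition small_deviation (R : realType) (V : finType) (EOS : V) (L : nat)
    (eps : R) (u : seq V -> R) : Prop :=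
  forall (o a : seq V) (i : nat), optimal EOS L u o -> first_deviation o a i ->
    `|u (take i o) - u (take i a)| <= eps.

Record tlb_instance (R : realType) (V : finType) (EOS : V) (L T d : nat)
    (sigma eps : R) := TLBInstance {
  theta : 'rV[R]_d;
  embed : seq V -> seq V -> 'rV[R]_d;
  query : 'I_T -> seq V;
  noise_display : measure_display;
  noise_space : measurableType noise_display;
  noise_prob : probability noise_space R;
  noise : 'I_T -> {RV noise_prob >-> R};
  theta_le1 : norm2 theta <= 1;
  embed_le1 : forall x y : seq V, norm2 (embed x y) <= 1;
  utility_ge0 : forall (t : 'I_T) (y : seq V),
    0 <= dotp theta (embed (query t) y);
  utility_monotone : forall t : 'I_T,
    monotone EOS (fun y => dotp theta (embed (query t) y));
  utility_deviation : forall t : 'I_T,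
    small_deviation EOS L eps (fun y => dotp theta (embed (query t) y));
  noise_mean0 : forall t : 'I_T, ('E_noise_prob[noise t] = 0)%E;
  noise_bounded : forall (t : 'I_T) (w : noise_space), `|noise t w| <= sigma
}.

(* What [f = e(x, .)] reveals when it is queried only at sequences of length
   at most [k]. *)
Definition view (R : realType) (V : finType) (d : nat)
    (f : seq V -> 'rV[R]_d) (k : nat) : seq V -> option 'rV[R]_d :=
  fun z => if (size z <= k)%N then Some (f z) else None.

Record round_log (R : realType) (V : finType) (d : nat) := RoundLog {
  log_query : seq V;
  log_view : seq V -> option 'rV[R]_d;
  log_output : seq V
}.

(* [policy past rs x w y] is the law of the next action after the rounds
   [past] with observed rewards [rs], when the current query is [x], the tokens
   [y] have been chosen and [w] is the accessible part of [e(x, .)]: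
   [Some a] appends the token [a] and [None] submits [y]. *)
Definition policy_type (R : realType) (V : finType) (d : nat) : Type :=
  seq (round_log R V d) -> seq R -> seq V -> (seq V -> option 'rV[R]_d) ->
  seq V -> option V -> R.

(* Probability that the sequence built in a round is [y]. Query access to [f]
   follows the decoding: with [k] tokens chosen, the one-token extensions of
   the current prefix, and more generally all sequences of length at most
   [k.+1], can be queried, but not longer ones.
   A sequence that has reached length [L] is submitted automatically. *)
Definition output_prob (R : realType) (V : finType) (EOS : V) (L d : nat)
    (p : policy_type R V d) (past : seq (round_log R V d)) (rs : seq R)
    (x : seq V) (f : seq V -> 'rV[R]_d) (y : seq V) : R :=
  (\prod_(k < size y)
     p past rs x (view f k.+1) (take k y) (Some (nth EOS y k)))
  * (if size y == L then 1 else p past rs x (view f (size y).+1) y None).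

Record algorithm (R : realType) (V : finType) (EOS : V) (L d : nat) :=
  Algorithm {
  policy : policy_type R V d;
  policy_ge0 : forall past rs x w y a, 0 <= policy past rs x w y a;
  policy_sum1 : forall past rs x w y,
    \sum_(a : option V) policy past rs x w y a = 1;
  policy_measurable : forall (t : nat) past x w y a,
    measurable_fun [set: t.-tuple R]
      (fun rs : t.-tuple R => policy past rs x w y a);
  policy_complete : forall past rs x f (y : seq V),
    (size y <= L)%N -> ~~ complete EOS y ->
    output_prob EOS L policy past rs x f y = 0
}.

Definition utility (R : realType) (V : finType) (EOS : V) (L T d : nat)
    (sigma eps : R) (I : tlb_instance EOS L T d sigma eps) (t : 'I_T)
    (y : seq V) : R :=
  dotp (theta I) (embed I (query I t) y).

Definition reward (R : realType) (V : finType) (EOS : V) (L T d : nat)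
    (sigma eps : R) (I : tlb_instance EOS L T d sigma eps) (t : 'I_T)
    (w : noise_space I) (y : seq V) : R :=
  utility I t y + noise I t w.

Definition past_logs (R : realType) (V : finType) (EOS : V) (L T d : nat)
    (sigma eps : R) (I : tlb_instance EOS L T d sigma eps)
    (ys : {ffun 'I_T -> L.-bseq V}) (t : 'I_T) : seq (round_log R V d) :=
  [seq RoundLog (query I s) (view (embed I (query I s)) (size (ys s)).+1) (ys s)
     | s <- take t (enum 'I_T)].

Definition past_rewards (R : realType) (V : finType) (EOS : V) (L T d : nat)
    (sigma eps : R) (I : tlb_instance EOS L T d sigma eps)
    (w : noise_space I) (ys : {ffun 'I_T -> L.-bseq V}) (t : 'I_T) : seq R :=
  [seq reward s w (ys s) | s <- take t (enum 'I_T)].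

(* Given the noise [w], the probability that the outputs of the rounds are
   [ys]. *)
Definition trajectory_prob (R : realType) (V : finType) (EOS : V)
    (L T d : nat) (sigma eps : R) (A : algorithm R EOS L d)
    (I : tlb_instance EOS L T d sigma eps) (w : noise_space I)
    (ys : {ffun 'I_T -> L.-bseq V}) : R :=
  \prod_(t < T) output_prob EOS L (policy A) (past_logs I ys t)
    (past_rewards w ys t) (query I t) (embed I (query I t)) (ys t).

(* Over finitely many sequences, so this supremum is a maximum when [0 < L]. *)
Definition best_reward (R : realType) (V : finType) (EOS : V) (L T d : nat)
    (sigma eps : R) (I : tlb_instance EOS L T d sigma eps) (t : 'I_T)
    (w : noise_space I) : R :=
  sup [set reward t w z | z in [set z | complete EOS z /\ (size z <= L)%N]].

Definition mean_reward (R : realType) (V : finType) (EOS : V) (L T d : nat)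
    (sigma eps : R) (A : algorithm R EOS L d)
    (I : tlb_instance EOS L T d sigma eps) (t : 'I_T) (w : noise_space I) : R :=
  \sum_(ys : {ffun 'I_T -> L.-bseq V})
    trajectory_prob A w ys * reward t w (ys t).

Definition regret (R : realType) (V : finType) (EOS : V) (L T d : nat)
    (sigma eps : R) (A : algorithm R EOS L d)
    (I : tlb_instance EOS L T d sigma eps) : \bar R :=
  (\sum_(t < T) 'E_(noise_prob I)[best_reward t]
   - \sum_(t < T) 'E_(noise_prob I)[mean_reward A t])%E.

(* Main.v *)
(* With [a] a token other than [EOS], hide in every round one of the two
   sequences [EOS a ... a] and [a a ... a] of length [L - 1] (so [L >= 3]), and
   give utility 1 to its strict extensions and 0 to all other sequences. All
   deviations then cost nothing and there is no noise, but while the first token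
   is chosen only sequences of utility 0 can be queried: against a fair hidden
   bit it is right with probability at most 1/2. Each round has its own query,
   hence its own bit, so averaging over all bits gives an instance of regret at
   least [T / 2]. For [L <= 2] the lower bound is nonpositive. *)
Require Import Defs.
From mathcomp Require Import all_boot all_order all_algebra.
From mathcomp Require Import all_classical all_reals all_analysis.

Import Order.TTheory GRing.Theory Num.Theory.
Import numFieldNormedType.Exports.

Local Open Scope classical_set_scope.
Local Open Scope ring_scope.

Set Implicit Arguments.
Unset Strict Implicit.
Unset Printing Implicit Defensive.

(** * Sums of causal products over all trajectories *)

Definition resample (T : nat) (Z : finType) (zs : {ffun 'I_T -> Z}) (t : 'I_T)
    (z : Z) : {ffun 'I_T -> Z} :=
  [ffun s => if s == t then z else zs s].

(** Exchanging the new value [z] with the overwritten [zs t] is an involution on pairs, so each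
    assignment arises [#|Z|] times. *)
Lemma sum_resample (R : realType) (T : nat) (Z : finType) (t : 'I_T)
    (G : {ffun 'I_T -> Z} -> R) :
  \sum_zs \sum_z G (resample zs t z) = #|Z|%:R * \sum_zs G zs.
Proof.
rewrite pair_big /=.
pose swap (p : {ffun 'I_T -> Z} * Z) := (resample p.1 t p.2, p.1 t).
have swapK : involutive swap.
  move=> [zs z]; rewrite /swap /=; congr (_, _); last by rewrite ffunE eqxx.
  by apply/ffunP => s; rewrite !ffunE; case: eqP => [->|].
rewrite (reindex_inj (inv_inj swapK)) /=.
rewrite (eq_bigr (fun p => G p.1)); last first.
  by move=> p _; congr G; exact: (congr1 fst (swapK p)).
rewrite -(pair_big predT predT (fun zs _ => G zs)) mulr_sumr /=.
by apply: eq_bigr => zs _; rewrite sumr_const mulr_natl.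
Qed.

(* Integrating out the coordinates from the last one to the first. *)
Lemma causal_sum_le (R : realType) (T : nat) (Z : finType)
    (F : 'I_T -> {ffun 'I_T -> Z} -> R) (c : 'I_T -> R) :
  (forall s zs, 0 <= F s zs) ->
  (forall (s t : 'I_T) zs z, (s < t)%N -> F s (resample zs t z) = F s zs) ->
  (forall s, 0 <= c s) ->
  (forall s zs, \sum_z F s (resample zs s z) <= c s) ->
  \sum_zs \prod_s F s zs <= \prod_s c s.
Proof.
move=> F_ge0 F_causal c_ge0 F_le.
(* An empty [Z] is treated apart because a power of [#|Z|] is cancelled at the end. *)
have [Z0|Zn0] := eqVneq #|Z| 0%N.
  case: T F c F_ge0 F_causal c_ge0 F_le => [|T] F c F_ge0 F_causal c_ge0 F_le.
    rewrite [leRHS]big_ord0 (eq_bigr (fun=> 1)) => [|zs _]; last first.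
      by rewrite big_ord0.
    by rewrite sumr_const card_ffun Z0 card_ord expn0.
  rewrite big1 ?prodr_ge0// => zs _.
  by have := card0_eq Z0 (zs ord0).
(* The first [k] factors ignore the other [T - k] coordinates, each of which multiplies the sum by
   [#|Z|]; the power [#|Z| ^+ k] brings the normalization to [#|Z| ^+ T] for every [k]. *)
have partial (k : nat) : (k <= T)%N ->
    #|Z|%:R ^+ k * \sum_zs \prod_(s < T | (s < k)%N) F s zs
      <= #|Z|%:R ^+ T * \prod_(s < T | (s < k)%N) c s.
  elim: k => [_|k IHk kT].
    rewrite expr0 mul1r [X in _ * X]big_pred0 // mulr1 (eq_bigr (fun=> 1)).
      by rewrite sumr_const card_ffun card_ord natrX.
    by move=> zs _; rewrite big_pred0.
  pose t := Ordinal kT.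
  have splitk (h : 'I_T -> R) :
      \prod_(s < T | (s < k.+1)%N) h s = h t * \prod_(s < T | (s < k)%N) h s.
    rewrite (bigD1 t) //=; congr (_ * _); apply: eq_bigl => s.
    by rewrite -val_eqE /= ltnS ltn_neqAle andbC.
  (* One factor [#|Z|] pays for resampling coordinate [t], on which the earlier factors do not
     depend. *)
  rewrite exprSr -mulrA -(sum_resample t) splitk mulrCA.
  apply: le_trans (ler_wpM2l (c_ge0 t) (IHk (ltnW kT))).
  rewrite mulrCA ler_wpM2l ?exprn_ge0// mulr_sumr ler_sum// => zs _.
  under eq_bigr => z _.
    rewrite splitk [X in _ * X](eq_bigr (F^~ zs)); last first.
      by move=> s sk; rewrite F_causal.
    over.
  by rewrite -mulr_suml ler_wpM2r ?prodr_ge0.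
have := partial T (leqnn T).
rewrite ler_pM2l ?exprn_gt0 ?ltr0n ?lt0n//.
have full (h : 'I_T -> R) : \prod_(s < T | (s < T)%N) h s = \prod_s h s.
  by apply: eq_bigl => s; rewrite ltn_ord.
by rewrite full (eq_bigr (fun zs => \prod_s F s zs)).
Qed.

(** * The law of the output of a single round *)

Fixpoint seqs_upto (V : finType) (n : nat) : seq (seq V) :=
  [::] :: if n is m.+1 then [seq a :: y | a <- enum V, y <- seqs_upto V m]
          else [::].

Lemma mem_seqs_upto (V : finType) (n : nat) (y : seq V) :
  (y \in seqs_upto V n) = (size y <= n)%N.
Proof.
elim: n y => [|n IHn] [|a y] //=; rewrite inE /=.
apply/allpairsP/idP => [[[b z] [_ zn [_ ->]]]|yn]; first by rewrite ltnS -IHn.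
by exists (a, y); split; rewrite ?mem_enum ?IHn.
Qed.

Lemma seqs_upto_uniq (V : finType) (n : nat) : uniq (seqs_upto V n).
Proof.
elim: n => [|n IHn] //=; rewrite allpairs_uniq ?enum_uniq//.
  by rewrite andbT; apply/allpairsP => -[[b z] [_ _]].
by move=> [a y] [b z] _ _ [-> ->].
Qed.

Lemma sum_bseq (R : realType) (V : finType) (n : nat) (F : seq V -> R) :
  \sum_(y : n.-bseq V) F y = \sum_(y <- seqs_upto V n) F y.
Proof.
rewrite -(big_map (fun y : n.-bseq V => y : seq V) predT F).
apply: perm_big; apply: uniq_perm; rewrite ?seqs_upto_uniq//.
  by rewrite map_inj_uniq ?index_enum_uniq//; exact: val_inj.
move=> y; rewrite mem_seqs_upto; apply/mapP/idP => [[z _ ->]|yn].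
  exact: size_bseq.
by exists (Bseq yn); rewrite ?mem_index_enum.
Qed.

Lemma sum_seqs_uptoS (R : realType) (V : finType) (n : nat) (F : seq V -> R) :
  \sum_(y <- seqs_upto V n.+1) F y
    = F [::] + \sum_(a : V) \sum_(y <- seqs_upto V n) F (a :: y).
Proof. by rewrite big_cons big_allpairs_dep big_enum. Qed.

Lemma sum_option (R : realType) (V : finType) (F : option V -> R) :
  \sum_a F a = F None + \sum_(a : V) F (Some a).
Proof.
rewrite (bigD1 None) //=; congr (_ + _).
rewrite (reindex_omap Some id) => [|[]] //=.
by apply: eq_bigl => a; rewrite eqxx.
Qed.

(** The output law for a policy that depends on the prefix alone. Fixing the first token leaves a
    law of the same form with a length bound lower by one. *)
Definition stopped_prob (R : realType) (V : finType) (EOS : V) (n : nat)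
    (p : seq V -> option V -> R) (y : seq V) : R :=
  (\prod_(k < size y) p (take k y) (Some (nth EOS y k)))
  * (if size y == n then 1 else p y None).

Lemma stopped_prob_cons (R : realType) (V : finType) (EOS : V) (n : nat)
    (p : seq V -> option V -> R) (a : V) (y : seq V) :
  stopped_prob EOS n.+1 p (a :: y)
    = p [::] (Some a) * stopped_prob EOS n (fun z => p (a :: z)) y.
Proof. by rewrite /stopped_prob /= big_ord_recl mulrA. Qed.

Lemma stopped_prob_nil (R : realType) (V : finType) (EOS : V) (n : nat)
    (p : seq V -> option V -> R) :
  stopped_prob EOS n.+1 p [::] = p [::] None.
Proof. by rewrite /stopped_prob /= big_ord0 mul1r. Qed.

(** Induction on the bound, conditioning on the first action; at bound 0 the empty sequence is
    submitted automatically. *)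
Lemma sum_stopped_prob (R : realType) (V : finType) (EOS : V) (n : nat)
    (p : seq V -> option V -> R) :
  (forall y, \sum_a p y a = 1) ->
  \sum_(y <- seqs_upto V n) stopped_prob EOS n p y = 1.
Proof.
elim: n p => [|n IHn] p p1.
  by rewrite big_seq1 /stopped_prob /= big_ord0 mulr1.
rewrite sum_seqs_uptoS stopped_prob_nil -(p1 [::]) sum_option; congr (_ + _).
apply: eq_bigr => a _; under eq_bigr do rewrite stopped_prob_cons.
by rewrite -mulr_sumr IHn ?mulr1.
Qed.

(** Once [b] is chosen, its continuations carry total mass 1. *)
Lemma sum_stopped_prob_first (R : realType) (V : finType) (EOS : V) (n : nat)
    (p : seq V -> option V -> R) (b : V) :
  (forall y, \sum_a p y a = 1) ->
  \sum_(y <- seqs_upto V n.+1)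
     stopped_prob EOS n.+1 p y * (ohead y == Some b)%:R = p [::] (Some b).
Proof.
move=> p1; rewrite sum_seqs_uptoS mulr0 add0r (bigD1 b) //= eqxx.
rewrite [X in _ + X]big1 ?addr0 => [|a /negPf ab]; last first.
  rewrite big1 // => y _.
  by rewrite (_ : (Some a == Some b) = (a == b)) // ab mulr0.
under eq_bigr do rewrite mulr1 stopped_prob_cons.
by rewrite -mulr_sumr sum_stopped_prob ?mulr1.
Qed.

Lemma stopped_prob_ge0 (R : realType) (V : finType) (EOS : V) (n : nat)
    (p : seq V -> option V -> R) (y : seq V) :
  (forall z a, 0 <= p z a) -> 0 <= stopped_prob EOS n p y.
Proof.
by move=> p0; rewrite mulr_ge0 ?prodr_ge0//; case: ifP.
Qed.

(** The accessible part of [f] is determined by the length of the prefix, so it can be absorbed into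
    the policy. *)
Lemma output_probE (R : realType) (V : finType) (EOS : V) (L d : nat)
    (p : policy_type R V d) past rs x (f : seq V -> 'rV[R]_d) (y : seq V) :
  output_prob EOS L p past rs x f y
    = stopped_prob EOS L (fun z => p past rs x (view f (size z).+1) z) y.
Proof.
congr (_ * _); apply: eq_bigr => k _.
by rewrite size_take_min (minn_idPl (ltnW (ltn_ord k))).
Qed.

(** * Averaging over hidden bits *)

Lemma sum_ffun_pair (R : realType) (I X Y : finType)
    (G : {ffun I -> X * Y} -> R) :
  \sum_zs G zs = \sum_(xs : {ffun I -> X}) \sum_(ys : {ffun I -> Y})
    G [ffun i => (xs i, ys i)].
Proof.
rewrite pair_big /=.
pose unzip (zs : {ffun I -> X * Y}) :=
  ([ffun i => (zs i).1], [ffun i => (zs i).2]).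
pose zip (p : {ffun I -> X} * {ffun I -> Y}) := [ffun i => (p.1 i, p.2 i)].
rewrite (reindex zip) //; exists unzip => [[xs ys] _|zs _].
  by congr (_, _); apply/ffunP => i; rewrite !ffunE.
by apply/ffunP => i; rewrite !ffunE /=; case: (zs i).
Qed.

(* Averaging over the bits: with uniform [xs], a round contributes at most
   [1 / 2] to the expected sum of the [w]'s. *)
Lemma exists_bad_bits (R : realType) (T : nat) (Y : finType)
    (K : 'I_T -> {ffun 'I_T -> bool * Y} -> R) (w : bool * Y -> R) :
  (forall s zs, 0 <= K s zs) ->
  (forall (s t : 'I_T) zs z, (s < t)%N -> K s (resample zs t z) = K s zs) ->
  (forall z, 0 <= w z) ->
  (forall s zs, \sum_z K s (resample zs s z) <= 2) ->
  (forall s zs, \sum_z K s (resample zs s z) * w z <= 1) ->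
  exists xs : {ffun 'I_T -> bool},
    \sum_t \sum_(ys : {ffun 'I_T -> Y})
      \prod_s K s [ffun i => (xs i, ys i)] * w (xs t, ys t)
      <= T%:R / 2.
Proof.
move=> K_ge0 K_causal w_ge0 K_sum Kw_sum.
pose H t zs := \prod_s K s zs * w (zs t).
have H_le (t : 'I_T) : \sum_zs H t zs <= 2 ^+ T / 2.
  (* Counting [w] in round [t] lowers the bound for that round from 2 to 1, so the product of the
     bounds is half of [2 ^+ T]. *)
  pose c (s : 'I_T) : R := if s == t then 1 else 2.
  pose F s zs := K s zs * (if s == t then w (zs t) else 1).
  have -> : 2 ^+ T / 2 = \prod_s c s.
    rewrite [RHS](bigD1 t) //= {1}/c eqxx mul1r (eq_bigr (fun=> 2)).
      rewrite -[T in 2 ^+ T]card_ord -prodr_const (bigD1 t) //=.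
      by rewrite [_ * _ / _]mulrAC divff ?mul1r ?pnatr_eq0.
    by rewrite /c => s /negPf ->.
  rewrite (eq_bigr (fun zs => \prod_s F s zs)) => [|zs _]; last first.
    rewrite big_split /=; congr (_ * _).
    by rewrite [RHS](bigD1 t) //= eqxx big1 ?mulr1// => s /negPf ->.
  apply: causal_sum_le.
  - by move=> s zs; rewrite mulr_ge0//; case: ifP.
  - move=> s t' zs z st'; rewrite /F K_causal//; case: eqP => // st.
    by rewrite ffunE -val_eqE -st /= ltn_eqF.
  - by move=> s; rewrite /c; case: ifP.
  - move=> s zs; rewrite /F /c; case: eqP => [->|_].
      by under eq_bigr do rewrite [resample _ _ _ t]ffunE eqxx.
    by under eq_bigr do rewrite mulr1.
(* If every choice of bits exceeded [T / 2], summing over all [2 ^ T] choices would contradict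
   [H_le]. *)
apply/not_existsP => bad.
have : \sum_(xs : {ffun 'I_T -> bool}) (T%:R / 2 : R)
    < \sum_(xs : {ffun 'I_T -> bool}) \sum_t \sum_(ys : {ffun 'I_T -> Y})
        H t [ffun i => (xs i, ys i)].
  apply: ltr_sum => [|xs _].
    by apply/hasP; exists [ffun=> true]; rewrite ?mem_index_enum.
  rewrite real_ltNge ?num_real//; apply/negP => le.
  apply: (bad xs); apply: le_trans le.
  by under [leRHS]eq_bigr do under eq_bigr do rewrite /H ffunE.
rewrite exchange_big /=; apply/negP; rewrite -leNgt.
under eq_bigr do rewrite -sum_ffun_pair.
apply: le_trans (ler_sum _ (fun t _ => H_le t)) _.
rewrite !sumr_const card_ffun card_bool !card_ord.
by rewrite -[leLHS]mulr_natl -[leRHS]mulr_natl natrX mulrCA.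
Qed.

(** * Noiseless instances with 0/1-valued utilities *)

Definition axis (R : realType) (d : nat) (i0 : 'I_d) : 'rV[R]_d :=
  \row_j (j == i0)%:R.

Lemma dotp_axis (R : realType) (d : nat) (i0 : 'I_d) (r s : R) :
  dotp (r *: axis R i0) (s *: axis R i0) = r * s.
Proof.
rewrite /dotp (bigD1 i0) //= big1 ?addr0 => [|i /negPf ii0].
  by rewrite !mxE eqxx !mulr1.
by rewrite !mxE ii0 !mulr0.
Qed.

Lemma norm2_axis (R : realType) (d : nat) (i0 : 'I_d) (b : bool) :
  norm2 (b%:R *: axis R i0) <= 1.
Proof.
by rewrite /norm2 dotp_axis; case: b; rewrite ?mulr1 ?mulr0 ?sqrtr1 ?sqrtr0.
Qed.

Lemma dotp_axisl (R : realType) (d : nat) (i0 : 'I_d) (s : R) :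
  dotp (axis R i0) (s *: axis R i0) = s.
Proof. by rewrite -[X in dotp X]scale1r dotp_axis mul1r. Qed.

Lemma noise0_mean (R : realType) :
  ('E_(\d_tt : probability unit R)[(cst 0%R : {mfun unit >-> R})] = 0)%E.
Proof. exact: (@expectation_cst _ _ R (\d_tt)). Qed.

Lemma norm2_axis_le1 (R : realType) d (i0 : 'I_d) : norm2 (axis R i0) <= 1.
Proof. by have := norm2_axis R i0 true; rewrite scale1r. Qed.

(** One axis serves as [theta] and carries every embedding vector, so any 0/1-valued [u] is linearly
    realizable within the norm bounds. The definition is transparent because later proofs compute
    with its fields. *)
Definition noiseless (R : realType) (V : finType) (EOS : V) (L T d : nat)
    (sigma eps : R) (i0 : 'I_d) (q : 'I_T -> seq V)
    (u : seq V -> seq V -> bool) (sigma_ge0 : 0 <= sigma)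
    (mono : forall x, Defs.monotone EOS (fun y => (u x y)%:R : R))
    (dev : forall x, small_deviation EOS L eps (fun y => (u x y)%:R : R)) :
  tlb_instance EOS L T d sigma eps.
Proof.
refine (@TLBInstance R V EOS L T d sigma eps (axis R i0)
  (fun x y => (u x y)%:R *: axis R i0) q _ unit (\d_tt)
  (fun=> (cst 0 : {mfun unit >-> R})) _ _ _ _ _ _ _).
- exact: norm2_axis_le1.
- by move=> x y; exact: norm2_axis.
- by move=> t y; rewrite dotp_axisl.
- by move=> t; under eq_fun do rewrite dotp_axisl; exact: mono.
- by move=> t; under eq_fun do rewrite dotp_axisl; exact: dev.
- by move=> t; exact: noise0_mean.
- by move=> t w; rewrite normr0.
Defined.

Lemma reward_noiseless (R : realType) (V : finType) (EOS : V) (L T d : nat)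
    (sigma eps : R) (i0 : 'I_d) (q : 'I_T -> seq V) u
    (sigma_ge0 : 0 <= sigma) mono dev (t : 'I_T) w y :
  reward (I := @noiseless R V EOS L T d sigma eps i0 q u sigma_ge0 mono dev)
    t w y = (u (q t) y)%:R.
Proof. by rewrite /reward /utility /= dotp_axisl addr0. Qed.

(** With zero noise on a one-point space all rewards are constants, so the expectations
    disappear. *)
Lemma regret_noiseless (R : realType) (V : finType) (EOS : V) (L T d : nat)
    (sigma eps : R) (i0 : 'I_d) (q : 'I_T -> seq V) u
    (sigma_ge0 : 0 <= sigma) mono dev (A : algorithm R EOS L d) :
  let I := @noiseless R V EOS L T d sigma eps i0 q u sigma_ge0 mono dev in
  regret A I =
    (\sum_(t < T) sup [set (u (q t) z)%:R | z in
                        [set z | complete EOS z /\ (size z <= L)%N]]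
     - \sum_(t < T) \sum_(ys : {ffun 'I_T -> L.-bseq V})
         trajectory_prob A (tt : noise_space I) ys * (u (q t) (ys t))%:R)%:E.
Proof.
move=> I; rewrite /regret EFinB -!sumEFin; congr (_ - _)%E.
  apply: eq_bigr => t _.
  rewrite -(expectation_cst (noise_prob I)); congr expectation.
  apply/funext => w; rewrite /best_reward /=; congr sup.
  by apply: eq_imagel => z _; rewrite reward_noiseless.
apply: eq_bigr => t _.
rewrite -(expectation_cst (noise_prob I)); congr expectation.
by apply/funext => -[]; apply: eq_bigr => ys _; rewrite reward_noiseless.
Qed.

(** * Utilities that reward the strict extensions of a hidden prefix *)

(* Strictness makes the sequences that reveal [p] longer than [p]; extending [p]
   by any token, not only [EOS], keeps the last level free of deviations. *)
Definition wins (V : eqType) (p z : seq V) : bool :=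
  (size p < size z)%N && (take (size p) z == p).

(** If [y] is longer than [p], appending leaves the decisive prefix alone. Otherwise, as [y] ends in
    [EOS], a win of the extension would force [p] to end in [EOS] too. *)
Lemma wins_monotone (R : realType) (V : finType) (EOS : V) (p : seq V) :
  p != [::] -> last EOS p != EOS ->
  Defs.monotone EOS (fun z => (wins p z)%:R : R).
Proof.
move=> p0 pE; split=> [y k /andP[y0 /eqP yE]|y a /andP[y0 /eqP yE] aE].
  have [yp|py] := ltnP (size p) (size y).
    by rewrite /wins takel_cat ?(ltnW yp)// yp size_cat ltn_addr.
  suff -> : wins p (y ++ nseq k EOS) = false by rewrite /wins ltnNge py.
  apply/negbTE; apply/negP => /andP[_ /eqP pz]; case/negP: pE; apply/eqP.
  rewrite -pz take_cat ltnNge py /= last_cat yE.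
  by elim: (size p - size y)%N k {pz} => [|m IHm] [|k] //=.
rewrite ler_nat; have [yp|py] := ltnP (size p) (size y).
  by rewrite /wins -cats1 takel_cat ?(ltnW yp)// yp size_cat ltn_addr.
rewrite /wins [(_ < size y)%N]ltnNge py leqn0 eqb0.
apply/negP => /andP[]; rewrite size_rcons ltnS => py'.
rewrite -cats1 takel_cat// take_oversize// => /eqP yp.
by move: pE; rewrite -yp yE eqxx.
Qed.

(** Prefixes of length at most [size p] never win, and the only later level is [L]. There [a] shares
    its first [size p] tokens with the winning [o], so it wins as well. *)
Lemma wins_small_deviation (R : realType) (V : finType) (EOS : V) (L : nat)
    (eps : R) (p : seq V) :
  0 <= eps -> (size p).+1 = L ->
  small_deviation EOS L eps (fun z => (wins p z)%:R : R).
Proof.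
move=> eps_ge0 pL o a i [oC oL o_max] [/andP[i0 ioa] aoi _].
(* The competitor [rcons p EOS] has length exactly [L] and utility 1. *)
have po : wins p o.
  have := o_max (rcons p EOS); rewrite size_rcons pL leqnn /complete.
  rewrite last_rcons eqxx -size_eq0 size_rcons /= => /(_ isT isT).
  rewrite {1}/wins size_rcons ltnS leqnn -cats1 take_size_cat// eqxx ler_nat.
  by rewrite lt0b.
suff -> : wins p (take i a) = wins p (take i o) by rewrite subrr normr0.
move: ioa; rewrite leq_min => /andP[io ia].
have [ip|ip] := leqP i (size p).
  by rewrite /wins !size_takel// ltnNge ip.
have iE : i = (size p).+1.
  by apply/eqP; rewrite eqn_leq ip andbT pL (leq_trans io).
move: aoi po; rewrite iE /= => aoi /andP[_ /eqP po].
by rewrite /wins !size_takel -?iE// !take_takel ?iE// aoi.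
Qed.

(* [EOS] as a first token is allowed by monotonicity, since it is followed by
   [a], and is the only alternative to [a] when there are two tokens. *)
Definition secret (V : finType) (EOS a : V) (L : nat) (b : bool) : seq V :=
  (if b then a else EOS) :: nseq L.-2 a.

Lemma size_secret (V : finType) (EOS a : V) (L : nat) (b : bool) :
  (2 < L)%N -> (size (secret EOS a L b)).+1 = L.
Proof. by case: L => [|[|L]] //= _; rewrite size_nseq. Qed.

Lemma last_secret (V : finType) (EOS a : V) (L : nat) (b : bool) :
  (2 < L)%N -> last EOS (secret EOS a L b) = a.
Proof.
by case: L => [|[|[|L]]] //= _; elim: L.
Qed.

(** * An arbitrary algorithm facing the secrets *)

(** The length of a query identifies its round, so a single embedding function can hide a separate
    bit for each round; lengths from [T] on get the default [false]. *)
Definition bit (V : finType) (T : nat) (xs : {ffun 'I_T -> bool})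
    (x : seq V) : bool :=
  oapp xs false (insub (size x)).

Lemma bit_nseq (V : finType) (T : nat) (xs : {ffun 'I_T -> bool}) (a : V)
    (t : 'I_T) :
  bit xs (nseq t a) = xs t.
Proof. by rewrite /bit size_nseq valK. Qed.

Lemma mem_take_enum_ord (T : nat) (s t : 'I_T) :
  s \in take t (enum 'I_T) -> (s < t)%N.
Proof.
move=> /(map_f val); rewrite map_take val_enum_ord take_iota mem_iota add0n /=.
by rewrite leq_min => /andP[].
Qed.

Definition secret_embed (R : realType) (V : finType) (EOS a : V) (L d : nat)
    (i0 : 'I_d) (b : bool) (z : seq V) : 'rV[R]_d :=
  (wins (secret EOS a L b) z)%:R *: axis R i0.

(** The past is read off [zs], while the current pair is a separate argument. With bits and outputs
    both as free coordinates, each round can be resampled. *)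
Definition round_prob (R : realType) (V : finType) (EOS a : V) (L T d : nat)
    (i0 : 'I_d) (A : algorithm R EOS L d) (t : 'I_T)
    (zs : {ffun 'I_T -> bool * L.-bseq V}) : bool * L.-bseq V -> R :=
  let f := secret_embed R EOS a L i0 in
  fun z => output_prob EOS L (policy A)
    [seq RoundLog (nseq s a) (view (f (zs s).1) (size (zs s).2).+1) (zs s).2
       | s : 'I_T <- take t (enum 'I_T)]
    [seq (wins (secret EOS a L (zs s).1) (zs s).2)%:R
       | s : 'I_T <- take t (enum 'I_T)]
    (nseq t a) (f z.1) z.2.

Lemma round_prob_ge0 (R : realType) (V : finType) (EOS a : V) (L T d : nat)
    (i0 : 'I_d) (A : algorithm R EOS L d) (t : 'I_T) zs z :
  0 <= round_prob a i0 A t zs z.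
Proof.
rewrite /round_prob output_probE stopped_prob_ge0// => y c.
exact: policy_ge0.
Qed.

Lemma round_prob_resample (R : realType) (V : finType) (EOS a : V)
    (L T d : nat) (i0 : 'I_d) (A : algorithm R EOS L d) (s t : 'I_T) zs z :
  (s <= t)%N ->
  round_prob a i0 A s (resample zs t z) = round_prob a i0 A s zs.
Proof.
move=> st; apply/funext => z'; rewrite /round_prob.
have same r : r \in take s (enum 'I_T) -> resample zs t z r = zs r.
  move=> /mem_take_enum_ord rs; rewrite ffunE -val_eqE /=.
  by rewrite ltn_eqF ?(leq_trans rs).
by congr output_prob; apply/eq_in_map => r /same ->.
Qed.

Lemma sum_output_prob (R : realType) (V : finType) (EOS : V) (L d : nat)
    (A : algorithm R EOS L d) past rs x f :
  \sum_(y : L.-bseq V) output_prob EOS L (policy A) past rs x f y = 1.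
Proof.
rewrite (sum_bseq L (output_prob EOS L (policy A) past rs x f)).
under eq_bigr do rewrite output_probE.
by apply: sum_stopped_prob => y; exact: policy_sum1.
Qed.

(* The first token is chosen before the embedding of any sequence of positive
   utility can be queried. *)
Lemma sum_output_prob_wins (R : realType) (V : finType) (EOS a : V)
    (L d : nat) (i0 : 'I_d) (A : algorithm R EOS L d) past rs x b :
  (2 < L)%N ->
  \sum_(y : L.-bseq V) output_prob EOS L (policy A) past rs x
      (secret_embed R EOS a L i0 b) y * (wins (secret EOS a L b) y)%:R
    <= policy A past rs x (view (fun=> 0) 1) [::]
         (Some (if b then a else EOS)).
Proof.
move=> L2; set f := secret_embed R EOS a L i0 b.
have -> : view (fun=> 0) 1 = view f 1.
  (* The secret has length at least 2, so sequences of length at most 1 embed to 0 whatever the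
     bit. *)
  apply/funext => z; rewrite /view; have [z1|//] := leqP (size z) 1.
  rewrite /f /secret_embed /wins ltnNge (leq_trans z1) /= ?scale0r//.
pose p y := policy A past rs x (view f (size y).+1) y.
have p1 y : \sum_c p y c = 1 by exact: policy_sum1.
rewrite (sum_bseq L (fun y => output_prob EOS L (policy A) past rs x f y
  * (wins (secret EOS a L b) y)%:R)).
case: L L2 A @f @p p1 => // L L2 A f p p1.
rewrite -[leRHS]/(p [::] (Some (if b then a else EOS))).
rewrite -(sum_stopped_prob_first EOS L (if b then a else EOS) p1).
apply: ler_sum => y _; rewrite output_probE.
rewrite ler_wpM2l ?stopped_prob_ge0// => [z c|]; first exact: policy_ge0.
(* A winning output must start with the first token of the secret. *)
rewrite ler_nat /wins; case: y => [|c y] //=; rewrite eqseq_cons.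
by case: eqP => [->|]; rewrite ?andbF// eqxx leq_b1.
Qed.

(** Without noise the observed rewards are functions of the bits and outputs, so these determine the
    whole history. *)
Lemma noiseless_trajectory_prob (R : realType) (V : finType) (EOS a : V)
    (L T d : nat) (sigma eps : R) (i0 : 'I_d) (A : algorithm R EOS L d)
    (xs : {ffun 'I_T -> bool}) (sigma_ge0 : 0 <= sigma) mono dev
    (ys : {ffun 'I_T -> L.-bseq V}) :
  trajectory_prob A (tt : noise_space
    (@noiseless R V EOS L T d sigma eps i0 (fun t => nseq t a)
       (fun x => wins (secret EOS a L (bit xs x))) sigma_ge0 mono dev)) ys
  = \prod_t round_prob a i0 A t [ffun i => (xs i, ys i)] (xs t, ys t).
Proof.
apply: eq_bigr => t _; rewrite /round_prob /=.
congr output_prob.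
- by apply: eq_map => s; rewrite !ffunE /= bit_nseq.
- by apply: eq_map => s; rewrite reward_noiseless !ffunE /= bit_nseq.
- by rewrite bit_nseq.
Qed.

Lemma exists_bad_secrets (R : realType) (V : finType) (EOS a : V)
    (L T d : nat) (i0 : 'I_d) (A : algorithm R EOS L d) :
  (2 < L)%N -> a != EOS ->
  exists xs : {ffun 'I_T -> bool},
    \sum_t \sum_(ys : {ffun 'I_T -> L.-bseq V})
      \prod_s round_prob a i0 A s [ffun i => (xs i, ys i)] (xs s, ys s)
      * (wins (secret EOS a L (xs t)) (ys t))%:R <= T%:R / 2.
Proof.
move=> L2 aE.
have [|||||xs] := @exists_bad_bits R T (L.-bseq V)
    (fun s zs => round_prob a i0 A s zs (zs s))
    (fun z => (wins (secret EOS a L z.1) z.2)%:R).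
- by move=> s zs; exact: round_prob_ge0.
- move=> s t zs z st; rewrite round_prob_resample ?(ltnW st)// ffunE.
  by rewrite -val_eqE ltn_eqF.
- by move=> z; rewrite ler0n.
(* Each of the two bits contributes total mass 1, hence the bound 2. *)
- move=> s zs; under eq_bigr do rewrite round_prob_resample// ffunE eqxx.
  rewrite -(pair_bigA _ (fun b y => round_prob a i0 A s zs (b, y))) /=.
  by rewrite big_bool /round_prob /= !sum_output_prob.
- move=> s zs; under eq_bigr do rewrite round_prob_resample// ffunE eqxx.
  rewrite -(pair_bigA _ (fun b y => round_prob a i0 A s zs (b, y)
    * (wins (secret EOS a L b) y)%:R)) /=.
  rewrite big_bool /round_prob /=.
  (* The right guesses for the two bits are distinct actions, [a] and [EOS], under one and the same
     action law, so their probabilities add up to at most 1. *)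
  apply: le_trans (lerD (sum_output_prob_wins _ _ _ _ _ _ _ L2)
    (sum_output_prob_wins _ _ _ _ _ _ _ L2)) _.
  set past := map _ _; set rs := map _ _.
  rewrite -(policy_sum1 A past rs (nseq s a) (view (fun=> 0) 1) [::]).
  rewrite (bigD1 (Some a))//= (bigD1 (Some EOS)) ?addrA ?lerDl//=.
    by apply: sumr_ge0 => c _; exact: policy_ge0.
  by rewrite eq_sym; apply: contra aE => /eqP[->].
move=> xs_bad; exists xs; apply: le_trans xs_bad.
apply: ler_sum => t _; apply: ler_sum => ys _.
rewrite (eq_bigr (fun s => round_prob a i0 A s [ffun i => (xs i, ys i)]
  ([ffun i => (xs i, ys i)] s))) //.
by move=> s _; rewrite [in RHS]ffunE.
Qed.

Theorem proposition3p3 (R : realType) :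
  exists2 c : R, 0 < c &
    forall (V : finType) (EOS : V) (L T d : nat) (sigma : R) (eps : nat -> R),
      (1 < #|V|)%N -> (0 < d)%N -> 0 <= sigma ->
      (forall n : nat, 0 <= eps n) ->
      eps =O_\oo (fun n : nat => (Num.sqrt (n%:R : R))^-1) ->
      forall A : algorithm R EOS L d,
      exists I : tlb_instance EOS L T d sigma (eps T),
        ((c * (T%:R * (1 - ((2 : R) ^ (L%:Z - 2))^-1)))%:E
           <= regret A I)%E.
Proof.
(* For [2 < L] the optimum earns [T] and the algorithm at most [T / 2]; the factor multiplying [T]
   in the claim is at most 1, which leaves the constant 1/2. *)
exists 2^-1 => [|V EOS L T d sigma eps V1 d0 sigma_ge0 eps_ge0 _ A].
  by rewrite invr_gt0.
have [a aE] : exists a, a != EOS.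
  have /card_gt0P[a] : (0 < #|predC1 EOS|)%N by rewrite cardC1 -subn1 subn_gt0.
  by rewrite inE; exists a.
pose i0 := Ordinal d0.
have [L2|L2] := ltnP 2 L; last first.
  have mono (x : seq V) : Defs.monotone EOS (fun y => false%:R : R) by split.
  have dev (x : seq V) : small_deviation EOS L (eps T) (fun y => false%:R : R).
    by move=> o b i _ _; rewrite subrr normr0.
  exists (noiseless i0 (fun=> [::]) (u := fun _ _ => false) sigma_ge0 mono dev).
  rewrite regret_noiseless lee_fin.
  rewrite [X in _ <= _ - X]big1 ?subr0 => [|t _]; last first.
    by rewrite big1 // => ys _; rewrite mulr0.
  apply: (@le_trans _ _ 0).
    rewrite pmulr_rle0 ?invr_gt0// mulr_ge0_le0// subr_le0.
    (* The integer exponent is -2, -1 or 0, so the inverse power is 4, 2 or 1. *)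
    case: L L2 {A mono dev} => [|[|[|]]] // _;
      by rewrite /= ?invrK ?invr1// exprn_ege1 ?ler1n.
  apply: sumr_ge0 => t _; set S := (X in sup X).
  (* For [L = 0] no complete sequence is admissible, and the supremum of the empty set is 0 by
     convention. *)
  have [->|/set0P[r Sr]] := eqVneq S set0; first by rewrite sup0.
  have S0 r' : S r' -> r' = 0 by move=> [z _ <-].
  by rewrite -(S0 _ Sr) ub_le_sup//; exists 0 => r' /S0 ->.
have [xs xs_bad] := exists_bad_secrets T i0 A L2 aE.
pose u (x : seq V) := wins (secret EOS a L (bit xs x)).
have mono x : Defs.monotone EOS (fun y => (u x y)%:R : R).
  by apply: wins_monotone => //; rewrite last_secret.
have dev x : small_deviation EOS L (eps T) (fun y => (u x y)%:R : R).
  by apply: wins_small_deviation => //; exact: size_secret.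
exists (noiseless i0 (fun t => nseq t a) sigma_ge0 mono dev).
rewrite regret_noiseless lee_fin.
apply: (@le_trans _ _ (T%:R - T%:R / 2)).
  have -> : T%:R - T%:R / 2 = 2^-1 * T%:R :> R.
    by rewrite [X in X - _]splitr addrK mulrC.
  rewrite ler_wpM2l ?invr_ge0//.
  by rewrite ler_piMr// gerBl invr_ge0 exprz_ge0.
apply: lerB.
  rewrite -[T in T%:R]card_ord -sumr_const; apply: ler_sum => t _.
  apply: ub_le_sup; first by exists 1 => _ /= [z _ <-]; rewrite lern1 leq_b1.
  (* The secret closed by [EOS] just fits into length [L] and earns 1. *)
  exists (rcons (secret EOS a L (xs t)) EOS).
    split; last by rewrite size_rcons size_secret.
    by rewrite /complete last_rcons eqxx -size_eq0 size_rcons.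
  by rewrite /u bit_nseq /wins size_rcons ltnSn -cats1 take_size_cat// eqxx.
apply: le_trans xs_bad; apply: ler_sum => t _; apply: ler_sum => ys _.
by rewrite noiseless_trajectory_prob /u bit_nseq.
Qed.
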